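(* Let $k$ be a subfield of $\mathbb{R}$ and let $ABC$ be a triangle in $\mathbb{R}^2$ with $A,B,C \in k^2$, side lengths $BC = a$, $CA = b$, $AB = c$, inradius $r$ and exradii $r_A, r_B, r_C$. The following conditions are equivalent: (T1) At least one of the incenter $I$, the excenters $I_A, I_B, I_C$ relative to $A, B, C$, the Gergonne point $Ge$, and the Nagel point $Na$ of triangle $ABC$ lies in $k^2$. (T2) $a^2 \equiv b^2 \equiv c^2 \pmod{k^{\times 2}}$. If these equivalent conditions hold, then all of $I, I_A, I_B, I_C, Ge, Na$ lie in $k^2$; triangle $ABC$ can be obtained by scaling a triangle that is Heronian over $k$ by a factor $q\sqrt{d}$ for some positive $d, q \in k$; and $a^2, b^2, c^2, r^2, r_A^2, r_B^2, r_C^2$ are elements of $k^\times$ all congruent to $d$ modulo $k^{\times 2}$.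
   Context: $k^{\times 2} = \{q^2 : q \in k^\times\}$; for $x,y \in k^\times$, $x \equiv y \pmod{k^{\times 2}}$ means $x/y \in k^{\times 2}$. A triangle is Heronian over $k$ if its side lengths and its area all lie in $k$. The Gergonne point is the common point of the cevians from the vertices to the touch points of the incircle with the opposite sides; the Nagel point is the common point of the cevians from the vertices to the touch points of the corresponding excircles with the opposite sides. *)

(* Defs.v *)
From mathcomp Require Import all_boot all_order all_algebra.
From mathcomp Require Import reals.
Set Implicit Arguments.
Unset Strict Implicit.
Unset Printing Implicit Defensive.
Import Order.TTheory GRing.Theory Num.Theory.
Local Open Scope ring_scope.

(* A subfield [k] of the reals is a [divringClosed R] predicate, and the set   *)
(* k^2 of points with both coordinates in [k] is [mxOver k].                  *)

Definition nonzero_square (R : realType) (k : divringClosed R) (x : R) : Prop :=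
  exists q : R, [/\ q \in k, q != 0 & x = q ^+ 2].

Definition eqmod_squares (R : realType) (k : divringClosed R) (x y : R) : Prop :=
  nonzero_square k (x / y).

(* Euclidean distance: the norm that mathcomp-analysis puts on ['rV[R]_2] is  *)
(* the sup norm.                                                              *)
Definition dist (R : realType) (P Q : 'rV[R]_2) : R :=
  Num.sqrt (\sum_i (P 0 i - Q 0 i) ^+ 2).

Definition on_line (R : realType) (X Y P : 'rV[R]_2) : Prop :=
  exists t : R, P = (1 - t) *: X + t *: Y.

Definition on_segment (R : realType) (X Y P : 'rV[R]_2) : Prop :=
  exists t : R, 0 <= t <= 1 /\ P = (1 - t) *: X + t *: Y.

(* [A], [B], [C] are affinely independent. *)
Definition triangle (R : realType) (A B C : 'rV[R]_2) : Prop :=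
  row_free (col_mx (B - A) (C - A)).

Definition area (R : realType) (A B C : 'rV[R]_2) : R :=
  `|\det (col_mx (B - A) (C - A) : 'M[R]_2)| / 2.

Definition heronian (R : realType) (k : divringClosed R)
    (A B C : 'rV[R]_2) : Prop :=
  [/\ triangle A B C, dist B C \in k, dist C A \in k, dist A B \in k &
      area A B C \in k].

(* The line [XY] meets the circle of center [P] and radius [r] in [T] only. *)
Definition touches_at (R : realType) (P : 'rV[R]_2) (r : R)
    (X Y T : 'rV[R]_2) : Prop :=
  on_line X Y T /\
  forall Q : 'rV[R]_2, on_line X Y Q -> (dist P Q = r <-> Q = T).

(* [D], [E], [F] are the touch points on the sides [BC], [CA], [AB]. *)
Definition incircle_touching (R : realType) (A B C I : 'rV[R]_2) (r : R)
    (D E F : 'rV[R]_2) : Prop :=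
  [/\ 0 < r,
      touches_at I r B C D /\ on_segment B C D,
      touches_at I r C A E /\ on_segment C A E &
      touches_at I r A B F /\ on_segment A B F].

Definition incircle (R : realType) (A B C I : 'rV[R]_2) (r : R) : Prop :=
  exists D E F : 'rV[R]_2, incircle_touching A B C I r D E F.

(* The excircle relative to the first vertex [A]: it touches the side [BC] in *)
(* [D] and the extensions of the sides [AC] beyond [C] and [AB] beyond [B].    *)
Definition excircle_touching (R : realType) (A B C J : 'rV[R]_2) (s : R)
    (D : 'rV[R]_2) : Prop :=
  [/\ 0 < s,
      touches_at J s B C D /\ on_segment B C D,
      exists E : 'rV[R]_2, touches_at J s C A E /\ on_segment A E C &
      exists F : 'rV[R]_2, touches_at J s A B F /\ on_segment A F B].

Definition excircle (R : realType) (A B C J : 'rV[R]_2) (s : R) : Prop :=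
  exists D : 'rV[R]_2, excircle_touching A B C J s D.

Definition gergonne_point (R : realType) (A B C G : 'rV[R]_2) : Prop :=
  exists (I : 'rV[R]_2) (r : R) (D E F : 'rV[R]_2),
    incircle_touching A B C I r D E F /\
    [/\ on_segment A D G, on_segment B E G & on_segment C F G].

Definition nagel_point (R : realType) (A B C N : 'rV[R]_2) : Prop :=
  exists (JA JB JC : 'rV[R]_2) (sA sB sC : R) (D E F : 'rV[R]_2),
    [/\ excircle_touching A B C JA sA D,
        excircle_touching B C A JB sB E &
        excircle_touching C A B JC sC F] /\
    [/\ on_segment A D N, on_segment B E N & on_segment C F N].

(* Main.v *)
Require Import Defs.
From mathcomp Require Import all_boot all_order all_algebra.
From mathcomp Require Import ring lra.
From mathcomp Require Import reals.
Set Implicit Arguments.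
Unset Strict Implicit.
Unset Printing Implicit Defensive.
Import Order.TTheory GRing.Theory Num.Theory.
Local Open Scope ring_scope.

(* All six centers have barycentric coordinates that are rational in the side
   lengths: a : b : c for the incenter, with one sign reversed for an excenter,
   and (x : y : z), (1/x : 1/y : 1/z) for the Nagel and Gergonne points, where
   x = b + c - a, y = c + a - b, z = a + b - c.  Since A, B, C have coordinates
   in k and are affinely independent, such a center lies in k^2 iff its
   barycentric coordinates are proportional to elements of k; in each case this
   means that a : b : c is, i.e. that the ratios of the sides lie in k.  Then
   d = a^2 and q = 1 work. *)

(** * Coordinates, distances and Heron's formula *)

(** Twice the signed area; the sign makes [cross P B C / cross A B C] a barycentric coordinate of
    [P]. *)
Definition cross (R : realType) (A B C : 'rV[R]_2) : R :=
  (B 0 0 - A 0 0) * (C 0 1 - A 0 1) - (B 0 1 - A 0 1) * (C 0 0 - A 0 0).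

Lemma cross_rot (R : realType) (A B C : 'rV[R]_2) : cross B C A = cross A B C.
Proof. by rewrite /cross; ring. Qed.

Lemma det_cross (R : realType) (A B C : 'rV[R]_2) :
  \det (col_mx (B - A) (C - A) : 'M[R]_2) = cross A B C.
Proof.
set M := (X in \det X).
have M0 j : M 0 j = (B - A) 0 j.
  have -> : 0 = lshift 1 0 :> 'I_(1 + 1) by apply: val_inj.
  exact: col_mxEu.
have M1 j : M 1 j = (C - A) 0 j.
  have -> : 1 = rshift 1 0 :> 'I_(1 + 1) by apply: val_inj.
  exact: col_mxEd.
have E : lift 0 0 = 1 :> 'I_2 by apply: val_inj.
have E' : lift 1 0 = 0 :> 'I_2 by apply: val_inj.
have E0 : ord0 = 0 :> 'I_2 by apply: val_inj.
move: M M0 M1 => M M0 M1.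
rewrite (expand_det_row M 0) big_ord_recl big_ord1 !M0 /cofactor !det_mx11.
rewrite !mxE !(E0, E, E') !M1 !mxE /cross /=; ring.
Qed.

Lemma triangle_cross (R : realType) (A B C : 'rV[R]_2) :
  triangle A B C <-> cross A B C != 0.
Proof.
by rewrite /triangle (@row_free_unit _ 2) unitmxE unitfE det_cross.
Qed.

Lemma dist_ge0 (R : realType) (P Q : 'rV[R]_2) : 0 <= dist P Q.
Proof. exact: sqrtr_ge0. Qed.

Lemma dist_sqr (R : realType) (P Q : 'rV[R]_2) :
  dist P Q ^+ 2 = (P 0 0 - Q 0 0) ^+ 2 + (P 0 1 - Q 0 1) ^+ 2.
Proof.
rewrite sqr_sqrtr; last by apply: sumr_ge0 => i _; exact: sqr_ge0.
rewrite big_ord_recl big_ord1.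
by have -> : lift ord0 ord0 = 1 :> 'I_2 by apply: val_inj.
Qed.

Lemma rV2P (R : realType) (P Q : 'rV[R]_2) :
  P 0 0 = Q 0 0 -> P 0 1 = Q 0 1 -> P = Q.
Proof.
move=> e0 e1; apply/rowP; case=> [[|[|//]] i2].
- by have -> : Ordinal i2 = 0 by apply: val_inj.
- by have -> : Ordinal i2 = 1 by apply: val_inj.
Qed.

Lemma dist_gt0 (R : realType) (P Q : 'rV[R]_2) : P != Q -> 0 < dist P Q.
Proof.
rewrite lt_def dist_ge0 andbT; apply: contraNneq => PQ.
have := dist_sqr P Q; rewrite PQ expr0n => /esym /eqP.
rewrite paddr_eq0 ?sqr_ge0// !sqrf_eq0 !subr_eq0 => /andP[/eqP ? /eqP ?].
exact/eqP/rV2P.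
Qed.

Lemma cross_neq (R : realType) (A B C : 'rV[R]_2) :
  cross A B C != 0 -> [/\ B != C, C != A & A != B].
Proof.
by move=> d0; split; apply: contraNneq d0 => ->; apply/eqP; rewrite /cross; ring.
Qed.

(** Lagrange's identity for the vectors [B - A] and [C - A], with their inner product taken from the
    law of cosines. It shows later that no tangent length vanishes. *)
Lemma heron (R : realType) (A B C : 'rV[R]_2) :
  let a := dist B C in let b := dist C A in let c := dist A B in
  4 * cross A B C ^+ 2 =
  (a + b + c) * (b + c - a) * (c + a - b) * (a + b - c).
Proof.
move=> a b c.
(* Only even powers of the sides occur in this form, so [dist_sqr] removes all square roots. *)
have -> : (a + b + c) * (b + c - a) * (c + a - b) * (a + b - c) =
  4 * (b ^+ 2 * c ^+ 2) - (b ^+ 2 + c ^+ 2 - a ^+ 2) ^+ 2 by ring.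
by rewrite !dist_sqr /cross; ring.
Qed.

(** * Touch points, tangent lengths and tritangent centers *)

Lemma line_inj (R : realType) (X Y : 'rV[R]_2) (t u : R) :
  X != Y -> (1 - t) *: X + t *: Y = (1 - u) *: X + u *: Y -> t = u.
Proof.
move=> XY e; have : (t - u) *: (Y - X) = 0.
  move/eqP: e; rewrite -subr_eq0 => /eqP <-; apply/rowP => i; rewrite !mxE; ring.
by move/eqP; rewrite scaler_eq0 !subr_eq0 eq_sym orbC eq_sym (negPf XY) => /eqP.
Qed.

Lemma on_segment_param (R : realType) (X Y : 'rV[R]_2) (t : R) :
  X != Y -> on_segment X Y ((1 - t) *: X + t *: Y) -> 0 <= t <= 1.
Proof. by move=> XY [u [u01 /(line_inj XY)->]]. Qed.

Lemma beyond_param (R : realType) (X Y : 'rV[R]_2) (t : R) :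
  X != Y -> on_segment X ((1 - t) *: X + t *: Y) Y -> 1 <= t.
Proof.
move=> XY [u [/andP[u0 u1] e]].
(* [Y] has parameter 1 on its own line and, through the hypothesis, also [u * t]. *)
have tu : 1 = u * t.
  apply: (line_inj XY); rewrite [X in _ + X]scale1r [X in _ = X](_ : _ = Y).
    by rewrite subrr scale0r add0r.
  by rewrite [in RHS]e; apply/rowP => i; rewrite !mxE; ring.
have t0 : 0 <= t by rewrite leNgt; apply/negP => t0; nra.
nra.
Qed.

(* If [T] were not the foot of the perpendicular, its reflection in the foot
   would be a second common point of line and circle; so Pythagoras applies. *)
Lemma touches_pythagoras (R : realType) (P X Y : 'rV[R]_2) (r t : R) :
  X != Y -> touches_at P r X Y ((1 - t) *: X + t *: Y) ->
  dist P X ^+ 2 = r ^+ 2 + (t * dist X Y) ^+ 2 /\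
  dist P Y ^+ 2 = r ^+ 2 + ((1 - t) * dist X Y) ^+ 2.
Proof.
move=> XY [lT uT].
have dT : dist P ((1 - t) *: X + t *: Y) = r by apply/uT.
have l0 : dist X Y ^+ 2 != 0 by rewrite expf_neq0 ?gt_eqF ?dist_gt0.
(* [p] is the inner product of [P - T] and [Y - X], where [T] is the touch point. The foot of the
   perpendicular thus has parameter [t + u], and the reflection of [T] in it has [t + 2 * u]. *)
pose p := (P 0 0 - (1 - t) * X 0 0 - t * Y 0 0) * (Y 0 0 - X 0 0) +
          (P 0 1 - (1 - t) * X 0 1 - t * Y 0 1) * (Y 0 1 - X 0 1).
pose u := p / dist X Y ^+ 2.
have up : u * dist X Y ^+ 2 = p by rewrite /u divfK.
have u0 : t + 2 * u = t.
  apply: (line_inj XY); apply/uT; first by exists (t + 2 * u).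
  rewrite -dT; apply/eqP; rewrite -(@eqrXn2 _ 2) ?dist_ge0//; apply/eqP.
  move: up; rewrite !dist_sqr !mxE /p => up.
  have := congr1 (fun z => 4 * u * z) up; lra.
have p0 : p = 0 by rewrite -up; have -> : u = 0 by [lra]; rewrite mul0r.
move: p0; rewrite /p -{1 2}dT !exprMn !dist_sqr !mxE => p0.
split.
  have := congr1 (fun z => 2 * t * z) p0; lra.
have := congr1 (fun z => 2 * (1 - t) * z) p0; lra.
Qed.

Lemma sqr_inj (R : realType) (x y : R) :
  0 <= x -> 0 <= y -> x ^+ 2 = y ^+ 2 -> x = y.
Proof. by move=> x0 y0 /eqP; rewrite eqrXn2// => /eqP. Qed.

(** By Pythagoras the two tangent segments from a vertex have equal squares; the parameter bounds
    make them nonnegative, hence equal. The resulting linear system gives each tangent length as the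
    semiperimeter minus the opposite side. *)
Lemma incircle_lengths (R : realType) (A B C I D E F : 'rV[R]_2) (r : R) :
  cross A B C != 0 -> incircle_touching A B C I r D E F ->
  let a := dist B C in let b := dist C A in let c := dist A B in
  [/\ dist I A ^+ 2 = r ^+ 2 + ((b + c - a) / 2) ^+ 2,
      dist I B ^+ 2 = r ^+ 2 + ((c + a - b) / 2) ^+ 2 &
      dist I C ^+ 2 = r ^+ 2 + ((a + b - c) / 2) ^+ 2] /\
  exists tD tE tF : R,
   [/\ D = (1 - tD) *: B + tD *: C, E = (1 - tE) *: C + tE *: A &
       F = (1 - tF) *: A + tF *: B] /\
   [/\ 0 <= tD <= 1, 0 <= tE <= 1, 0 <= tF <= 1 &
   [/\ tD * a = (c + a - b) / 2, tE * b = (a + b - c) / 2 &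
       tF * c = (b + c - a) / 2]].
Proof.
move=> /cross_neq[BC CA AB] [_ [tchD sD] [tchE sE] [tchF sF]] a b c.
have [[[tD eD] _] [[tE eE] _] [[tF eF] _]] := And3 tchD tchE tchF.
subst D E F.
have tD01 := on_segment_param BC sD; have tE01 := on_segment_param CA sE.
have tF01 := on_segment_param AB sF.
have [DB DC] := touches_pythagoras BC tchD.
have [EC EA] := touches_pythagoras CA tchE.
have [FA FB] := touches_pythagoras AB tchF.
rewrite -/a -/b -/c in DB DC EC EA FA FB.
have [a0 b0 c0] : [/\ 0 <= a, 0 <= b & 0 <= c] by split; exact: dist_ge0.
have lC : (1 - tD) * a = tE * b by apply: sqr_inj; [nra|nra|lra].
have lA : (1 - tE) * b = tF * c by apply: sqr_inj; [nra|nra|lra].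
have lB : (1 - tF) * c = tD * a by apply: sqr_inj; [nra|nra|lra].
have LD : tD * a = (c + a - b) / 2 by lra.
have LE : tE * b = (a + b - c) / 2 by lra.
have LF : tF * c = (b + c - a) / 2 by lra.
rewrite FA DB EC LD LE LF; split=> //.
by exists tD, tE, tF.
Qed.

(** As for the incircle, but two touch points lie on extensions of sides. This changes signs in the
    linear system, and the tangent length from [A] becomes the semiperimeter. *)
Lemma excircle_lengths (R : realType) (A B C J D : 'rV[R]_2) (s : R) :
  cross A B C != 0 -> excircle_touching A B C J s D ->
  let a := dist B C in let b := dist C A in let c := dist A B in
  [/\ dist J A ^+ 2 = s ^+ 2 + ((a + b + c) / 2) ^+ 2,
      dist J B ^+ 2 = s ^+ 2 + ((a + b - c) / 2) ^+ 2 &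
      dist J C ^+ 2 = s ^+ 2 + ((c + a - b) / 2) ^+ 2] /\
  exists t : R,
    [/\ D = (1 - t) *: B + t *: C, 0 <= t <= 1 & t * a = (a + b - c) / 2].
Proof.
move=> /cross_neq[BC CA AB] [_ [tchD sD] [E [tchE sE]] [F [tchF sF]]] a b c.
have [[[tD eD] _] [[tE eE] _] [[tF eF] _]] := And3 tchD tchE tchF.
subst D E F.
have tD01 := on_segment_param BC sD.
have tF1 := beyond_param AB sF.
(* Read from [A] to [C], the point [E] has parameter [1 - tE]. *)
have tE0 : tE <= 0.
  have AC : A != C by rewrite eq_sym.
  suff : 1 <= 1 - tE by lra.
  by apply: (beyond_param AC); rewrite subKr addrC.
have [DB DC] := touches_pythagoras BC tchD.
have [EC EA] := touches_pythagoras CA tchE.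
have [FA FB] := touches_pythagoras AB tchF.
rewrite -/a -/b -/c in DB DC EC EA FA FB.
have [a0 b0 c0] : [/\ 0 <= a, 0 <= b & 0 <= c] by split; exact: dist_ge0.
have lC : (1 - tD) * a = - (tE * b) by apply: sqr_inj; [nra|nra|lra].
have lA : (1 - tE) * b = tF * c by apply: sqr_inj; [nra|nra|lra].
have lB : (tF - 1) * c = tD * a by apply: sqr_inj; [nra|nra|lra].
have LD : tD * a = (a + b - c) / 2 by lra.
split; last by exists tD.
rewrite EA DB DC LD.
have -> : (1 - tE) * b = (a + b + c) / 2 by lra.
by have -> : (1 - tD) * a = (c + a - b) / 2 by lra.
Qed.

(* The squared tangent lengths determine the center; [al], [be], [ga] are the
   side lengths, the sign of one of them being reversed for an excircle. *)
Lemma tritangent_center (R : realType) (A B C J : 'rV[R]_2) (s al be ga : R) :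
  cross A B C != 0 ->
  al ^+ 2 = dist B C ^+ 2 -> be ^+ 2 = dist C A ^+ 2 ->
  ga ^+ 2 = dist A B ^+ 2 ->
  dist J A ^+ 2 = s ^+ 2 + ((be + ga - al) / 2) ^+ 2 ->
  dist J B ^+ 2 = s ^+ 2 + ((ga + al - be) / 2) ^+ 2 ->
  dist J C ^+ 2 = s ^+ 2 + ((al + be - ga) / 2) ^+ 2 ->
  (al + be + ga) *: J = al *: A + be *: B + ga *: C /\
  s ^+ 2 * (al + be + ga) ^+ 2 = cross A B C ^+ 2.
Proof.
move=> d0; rewrite !dist_sqr => ea eb ec eA eB eC.
pose u0 := B 0 0 - A 0 0; pose u1 := B 0 1 - A 0 1.
pose v0 := C 0 0 - A 0 0; pose v1 := C 0 1 - A 0 1.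
pose j0 := J 0 0 - A 0 0; pose j1 := J 0 1 - A 0 1.
pose sg := al + be + ga.
have uu : u0 ^+ 2 + u1 ^+ 2 = ga ^+ 2 by rewrite ec /u0 /u1; ring.
have vv : v0 ^+ 2 + v1 ^+ 2 = be ^+ 2 by rewrite eb /v0 /v1; ring.
have uv : 2 * (u0 * v0 + u1 * v1) = be ^+ 2 + ga ^+ 2 - al ^+ 2.
  by rewrite eb ec ea /u0 /u1 /v0 /v1; ring.
(* Subtracting the distance equations of two vertices cancels [s] and leaves an equation linear in
   [J - A]. *)
have ju : 2 * (j0 * u0 + j1 * u1) = ga * (ga + be - al).
  by rewrite /j0 /j1 /u0 /u1; lra.
have jv : 2 * (j0 * v0 + j1 * v1) = be * (ga + be - al).
  by rewrite /j0 /j1 /v0 /v1; lra.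
have jj : j0 ^+ 2 + j1 ^+ 2 = s ^+ 2 + ((be + ga - al) / 2) ^+ 2.
  by rewrite -eA /j0 /j1; ring.
have dE : cross A B C = u0 * v1 - u1 * v0 by [].
(* The defect of the claimed formula, with origin [A]. It is orthogonal to the independent vectors
   [B - A] and [C - A], hence zero. *)
pose z0 := sg * j0 - be * u0 - ga * v0; pose z1 := sg * j1 - be * u1 - ga * v1.
have zu : z0 * u0 + z1 * u1 = 0.
  have := congr1 (fun x => sg * x) ju; have := congr1 (fun x => be * x) uu.
  by have := congr1 (fun x => ga * x) uv; rewrite /z0 /z1 /sg; lra.
have zv : z0 * v0 + z1 * v1 = 0.
  have := congr1 (fun x => sg * x) jv; have := congr1 (fun x => ga * x) vv.
  by have := congr1 (fun x => be * x) uv; rewrite /z0 /z1 /sg; lra.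
have z00 : z0 = 0.
  apply: (mulIf d0); rewrite dE mul0r.
  have := congr1 (fun x => v1 * x) zu; have := congr1 (fun x => u1 * x) zv; lra.
have z10 : z1 = 0.
  apply: (mulIf d0); rewrite dE mul0r.
  have := congr1 (fun x => v0 * x) zu; have := congr1 (fun x => u0 * x) zv; lra.
split.
  apply: rV2P; rewrite !mxE.
    by move: z00; rewrite /z0 /sg /j0 /u0 /v0; lra.
  by move: z10; rewrite /z1 /sg /j1 /u1 /v1; lra.
have Ej0 : sg * j0 = be * u0 + ga * v0 by move: z00; rewrite /z0; lra.
have Ej1 : sg * j1 = be * u1 + ga * v1 by move: z10; rewrite /z1; lra.
(* The radius follows by comparing the squared norm of [sg] times [J - A] with the Gram determinant
   of [B - A] and [C - A]. *)
have sjj : sg ^+ 2 * (j0 ^+ 2 + j1 ^+ 2) =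
    be ^+ 2 * (u0 ^+ 2 + u1 ^+ 2) + ga ^+ 2 * (v0 ^+ 2 + v1 ^+ 2) +
    be * ga * (2 * (u0 * v0 + u1 * v1)).
  by rewrite mulrDr -!exprMn Ej0 Ej1; ring.
have dd : 4 * cross A B C ^+ 2 =
    4 * ((u0 ^+ 2 + u1 ^+ 2) * (v0 ^+ 2 + v1 ^+ 2)) -
    (2 * (u0 * v0 + u1 * v1)) ^+ 2.
  by rewrite dE; ring.
move: sjj dd; rewrite jj uu vv uv /sg; lra.
Qed.

Lemma incenter_weights (R : realType) (A B C I : 'rV[R]_2) (r : R) :
  cross A B C != 0 -> incircle A B C I r ->
  let a := dist B C in let b := dist C A in let c := dist A B in
  (a + b + c) *: I = a *: A + b *: B + c *: C /\
  r ^+ 2 * (a + b + c) ^+ 2 = cross A B C ^+ 2.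
Proof.
move=> d0 [D [E [F /(incircle_lengths d0)[[eA eB eC] _]]]] a b c.
exact: tritangent_center.
Qed.

Lemma excenter_weights (R : realType) (A B C J : 'rV[R]_2) (s : R) :
  cross A B C != 0 -> excircle A B C J s ->
  let a := dist B C in let b := dist C A in let c := dist A B in
  (- a + b + c) *: J = - a *: A + b *: B + c *: C /\
  s ^+ 2 * (- a + b + c) ^+ 2 = cross A B C ^+ 2.
Proof.
move=> d0 [D /(excircle_lengths d0)[[eA eB eC] _]] a b c.
apply: tritangent_center => //; rewrite ?sqrrN//.
- by rewrite eA -/a -/b -/c; ring.
- by rewrite eB -/a -/b -/c; ring.
- by rewrite eC -/a -/b -/c; ring.
Qed.

(** * Barycentric weights of the Gergonne and Nagel points *)

Lemma areal_sum (R : realType) (A B C P : 'rV[R]_2) :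
  cross P B C + cross P C A + cross P A B = cross A B C.
Proof. by rewrite /cross; ring. Qed.

Lemma areal_weights (R : realType) (A B C P : 'rV[R]_2) (w u v w' : R) :
  cross A B C != 0 ->
  w * cross P B C = u * cross A B C -> w * cross P C A = v * cross A B C ->
  w * cross P A B = w' * cross A B C ->
  w *: P = u *: A + v *: B + w' *: C.
Proof.
move=> d0 eA eB eC.
have key i : cross A B C * P 0 i =
    cross P B C * A 0 i + cross P C A * B 0 i + cross P A B * C 0 i ->
    (w *: P) 0 i = (u *: A + v *: B + w' *: C) 0 i.
  move=> e; rewrite !mxE; apply: (mulfI d0).
  transitivity (w * cross P B C * A 0 i + w * cross P C A * B 0 i +
                w * cross P A B * C 0 i).
    by rewrite mulrCA e; ring.
  by rewrite eA eB eC; ring.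
by apply: rV2P; apply: key; rewrite /cross; ring.
Qed.

(** Since [cross _ B C] is affine and vanishes at [B] and [C], only the term of [A] survives. Cyclic
    relabelling gives the other two weights. *)
Lemma weights_areal (R : realType) (A B C P : 'rV[R]_2) (u v w : R) :
  (u + v + w) *: P = u *: A + v *: B + w *: C ->
  (u + v + w) * cross P B C = u * cross A B C.
Proof.
move=> /rowP e; have := e 0; have := e 1; rewrite !mxE /cross => e1 e0.
have := congr1 (fun x => x * (B 0 1 - C 0 1)) e0.
have := congr1 (fun x => x * (B 0 0 - C 0 0)) e1.
lra.
Qed.

(** Along the cevian from [A], the areas on its two sides keep the ratio in which its foot divides
    [B C]. *)
Lemma cevian_areal (R : realType) (A B C P : 'rV[R]_2) (t : R) :
  on_segment A ((1 - t) *: B + t *: C) P ->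
  t * cross P C A = (1 - t) * cross P A B.
Proof. by case=> g [_ ->]; rewrite /cross !mxE; ring. Qed.

(** The feet divide the sides in ratios of tangent lengths, so [x * al = y * be = z * ga] for the
    areal coordinates. These are therefore as 1/x : 1/y : 1/z, here with denominators cleared. *)
Lemma gergonne_weights (R : realType) (A B C G : 'rV[R]_2) :
  cross A B C != 0 -> gergonne_point A B C G ->
  let a := dist B C in let b := dist C A in let c := dist A B in
  let x := b + c - a in let y := c + a - b in let z := a + b - c in
  [/\ 0 < x, 0 < y & 0 < z] /\
  (y * z + z * x + x * y) *: G =
    (y * z) *: A + (z * x) *: B + (x * y) *: C.
Proof.
move=> d0 [I [r [D [E [F [tch [sD sE sF]]]]]]] a b c x y z.
have [_ [tD [tE [tF [[eD eE eF] [D01 E01 F01 [lD lE lF]]]]]]] :=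
  incircle_lengths d0 tch.
subst D E F; rewrite -/a -/b -/c in lD lE lF.
have [a0 b0 c0] : [/\ 0 <= a, 0 <= b & 0 <= c] by split; exact: dist_ge0.
(* The tangent lengths are nonnegative by the segment bounds; Heron's formula makes them nonzero. *)
have /and4P[_ x0 y0 z0] : [&& a + b + c != 0, x != 0, y != 0 & z != 0].
  have : 4 * cross A B C ^+ 2 != 0 by rewrite mulf_neq0 ?expf_neq0// pnatr_eq0.
  by rewrite heron -/a -/b -/c -/x -/y -/z !mulf_eq0 !negb_or -!andbA.
split.
  rewrite !lt_def x0 y0 z0 /x /y /z /=; split; nra.
have := cevian_areal sD; have := cevian_areal sE; have := cevian_areal sF.
set al := cross G B C; set be := cross G C A; set ga := cross G A B.
(* Multiplying by twice the side turns the parameters into [x], [y], [z]. *)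
move=> /(congr1 (fun u => 2 * c * u)) eF /(congr1 (fun u => 2 * b * u)) eE.
move=> /(congr1 (fun u => 2 * a * u)) eD.
have {}eD : y * be = z * ga.
  have := congr1 (fun u => u * be) lD; have := congr1 (fun u => u * ga) lD.
  rewrite /y /z; lra.
have {}eE : z * ga = x * al.
  have := congr1 (fun u => u * ga) lE; have := congr1 (fun u => u * al) lE.
  rewrite /x /z; lra.
have dE := areal_sum A B C G; rewrite -/al -/be -/ga in dE.
apply: areal_weights => //; rewrite -/al -/be -/ga -dE.
- have := congr1 (fun u => z * u) eD; have := congr1 (fun u => z * u) eE.
  have := congr1 (fun u => y * u) eE; lra.
- have := congr1 (fun u => z * u) eD; have := congr1 (fun u => z * u) eE.
  have := congr1 (fun u => x * u) eD; lra.
- have := congr1 (fun u => y * u) eE; have := congr1 (fun u => x * u) eD; lra.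
Qed.

(** On each side the excircle touch point mirrors the incircle one in the midpoint. The division
    ratios are inverted, and so the weights become [x], [y], [z] themselves. *)
Lemma nagel_weights (R : realType) (A B C N : 'rV[R]_2) :
  cross A B C != 0 -> nagel_point A B C N ->
  let a := dist B C in let b := dist C A in let c := dist A B in
  let x := b + c - a in let y := c + a - b in let z := a + b - c in
  (x + y + z) *: N = x *: A + y *: B + z *: C.
Proof.
move=> d0 [JA [JB [JC [sA [sB [sC [D [E [F [[tA tB tC] [cD cE cF]]]]]]]]]]].
have d1 : cross B C A != 0 by rewrite cross_rot.
have d2 : cross C A B != 0 by rewrite -cross_rot.
have [_ [tD [eD _ lD]]] := excircle_lengths d0 tA.
have [_ [tE [eE _ lE]]] := excircle_lengths d1 tB.
have [_ [tF [eF _ lF]]] := excircle_lengths d2 tC.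
move=> a b c x y z; subst D E F; rewrite -/a -/b -/c in lD lE lF.
have := cevian_areal cD; have := cevian_areal cE; have := cevian_areal cF.
set al := cross N B C; set be := cross N C A; set ga := cross N A B.
move=> /(congr1 (fun u => 2 * c * u)) eF /(congr1 (fun u => 2 * b * u)) eE.
move=> /(congr1 (fun u => 2 * a * u)) eD.
have {}eD : z * be = y * ga.
  have := congr1 (fun u => u * be) lD; have := congr1 (fun u => u * ga) lD.
  rewrite /y /z; lra.
have {}eE : x * ga = z * al.
  have := congr1 (fun u => u * ga) lE; have := congr1 (fun u => u * al) lE.
  rewrite /x /z; lra.
have {}eF : y * al = x * be.
  have := congr1 (fun u => u * al) lF; have := congr1 (fun u => u * be) lF.
  rewrite /x /y; lra.
have dE := areal_sum A B C N; rewrite -/al -/be -/ga in dE.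
apply: areal_weights => //; rewrite -/al -/be -/ga -dE.
- by transitivity (x * al + y * al + z * al); [ring | rewrite eF -eE; ring].
- by transitivity (x * be + y * be + z * be); [ring | rewrite -eF eD; ring].
- by transitivity (x * ga + y * ga + z * ga); [ring | rewrite -eD eE; ring].
Qed.

(** * Proportionality over [k] and square classes *)

(** The factor [l] is any nonzero real, possibly outside [k]: only the ratio [x : y : z] matters, as
    for homogeneous coordinates. *)
Definition commensurable (R : realType) (k : divringClosed R) (x y z : R) :=
  exists l : R, [/\ l != 0, l * x \in k, l * y \in k & l * z \in k].

Lemma cross_in (R : realType) (k : divringClosed R) (A B C : 'rV[R]_2) :
  A \is a mxOver k -> B \is a mxOver k -> C \is a mxOver k -> cross A B C \in k.
Proof.
move=> /mxOverP hA /mxOverP hB /mxOverP hC.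
by rewrite /cross !(rpredB, rpredM).
Qed.

(** Normalized weights of [P] are quotients of signed areas, which lie in [k] if all points do.
    Conversely, weights scaled into [k] give [P] after division by their sum. *)
Lemma weights_mxOver (R : realType) (k : divringClosed R)
    (A B C P : 'rV[R]_2) (u v w : R) :
  A \is a mxOver k -> B \is a mxOver k -> C \is a mxOver k ->
  cross A B C != 0 -> u + v + w != 0 ->
  (u + v + w) *: P = u *: A + v *: B + w *: C ->
  P \is a mxOver k <-> commensurable k u v w.
Proof.
move=> hA hB hC d0 s0 e; split=> [hP|[l [l0 lu lv lw]]].
  have d1 : cross B C A != 0 by rewrite cross_rot.
  have d2 : cross C A B != 0 by rewrite -cross_rot.
  have eA := weights_areal e.
  have eB : (v + w + u) * cross P C A = v * cross B C A.
    by apply: weights_areal; rewrite addrC addrA e -addrA addrC.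
  have eC : (w + u + v) * cross P A B = w * cross C A B.
    by apply: weights_areal; rewrite -addrA addrC e addrC addrA.
  exists (u + v + w)^-1; rewrite invr_eq0; split=> //.
  - suff -> : (u + v + w)^-1 * u = cross P B C / cross A B C.
      by rewrite rpred_div ?cross_in.
    by apply/eqP; rewrite mulrC eqr_div// -eA mulrC.
  - suff -> : (u + v + w)^-1 * v = cross P C A / cross B C A.
      by rewrite rpred_div ?cross_in.
    by apply/eqP; rewrite mulrC eqr_div// -eB; apply/eqP; ring.
  - suff -> : (u + v + w)^-1 * w = cross P A B / cross C A B.
      by rewrite rpred_div ?cross_in.
    by apply/eqP; rewrite mulrC eqr_div// -eC; apply/eqP; ring.
move: hA hB hC => /mxOverP hA /mxOverP hB /mxOverP hC.
apply/mxOverP => i j; rewrite (ord1 i).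
have -> : P 0 j = (l * u * A 0 j + l * v * B 0 j + l * w * C 0 j) /
                  (l * u + l * v + l * w).
  have s1 : l * u + l * v + l * w != 0 by rewrite -!mulrDr mulf_neq0.
  apply: (canRL (mulfK s1)); have /rowP/(_ j) := e; rewrite !mxE => ej.
  by transitivity (l * ((u + v + w) * P 0 j)); [ring | rewrite ej; ring].
move: (l * u) (l * v) (l * w) lu lv lw => x y z xk yk zk.
by rewrite !(rpredM, rpredD, rpredV).
Qed.

Lemma commensurable_rot (R : realType) (k : divringClosed R)
    (x y z : R) :
  commensurable k x y z -> commensurable k y z x.
Proof. by case=> l [l0 lx ly lz]; exists l. Qed.

Lemma commensurableN (R : realType) (k : divringClosed R)
    (x y z : R) :
  commensurable k (- x) y z <-> commensurable k x y z.
Proof.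
by split=> -[l [l0 lx ly lz]]; exists l; split=> //;
  move: lx; rewrite mulrN rpredN.
Qed.

(** Serves the Gergonne point: quotients of the products are quotients of [x], [y], [z],
    inverted. *)
Lemma commensurable_inverses (R : realType) (k : divringClosed R)
    (x y z : R) :
  x != 0 -> y != 0 -> z != 0 ->
  commensurable k (y * z) (z * x) (x * y) <-> commensurable k x y z.
Proof.
move=> x0 y0 z0; split=> -[l [l0 lx ly lz]].
  exists x^-1; rewrite invr_eq0 x0 mulVf// rpred1; split=> //.
    suff -> : x^-1 * y = l * (y * z) / (l * (z * x)) by exact: rpred_div.
    by field; rewrite l0 x0 z0.
  suff -> : x^-1 * z = l * (y * z) / (l * (x * y)) by exact: rpred_div.
  by field; rewrite l0 x0 y0.
exists (l ^+ 2); rewrite expf_neq0//; split=> //.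
- by have -> : l ^+ 2 * (y * z) = l * y * (l * z) by [ring]; exact: rpredM.
- by have -> : l ^+ 2 * (z * x) = l * z * (l * x) by [ring]; exact: rpredM.
- by have -> : l ^+ 2 * (x * y) = l * x * (l * y) by [ring]; exact: rpredM.
Qed.

Lemma commensurable_tangents (R : realType) (k : divringClosed R)
    (x y z : R) :
  commensurable k (y + z - x) (z + x - y) (x + y - z) <-> commensurable k x y z.
Proof.
split=> -[l [l0 lx ly lz]]; last first.
  by exists l; rewrite !mulrBr !mulrDr; split=> //; rewrite rpredB ?rpredD.
(* The factor 2 clears the denominator in recovering sides from tangent lengths. *)
exists (2 * l); rewrite mulf_neq0 ?pnatr_eq0//; split=> //.
- have -> : 2 * l * x = l * (z + x - y) + l * (x + y - z) by ring.
  exact: rpredD.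
- have -> : 2 * l * y = l * (y + z - x) + l * (x + y - z) by ring.
  exact: rpredD.
- have -> : 2 * l * z = l * (y + z - x) + l * (z + x - y) by ring.
  exact: rpredD.
Qed.

(** If the squared ratio is [q ^+ 2] with [q] in [k], the ratio itself is [q] or [- q]. *)
Lemma eqmod_squares_ratio (R : realType) (k : divringClosed R)
    (x y : R) :
  x != 0 -> y != 0 ->
  eqmod_squares k (x ^+ 2) (y ^+ 2) <-> x / y \in k.
Proof.
move=> x0 y0; rewrite /eqmod_squares -expr_div_n; split=> [[q [qk _ /eqP]]|h].
  by rewrite eqf_sqr => /orP[]/eqP->; rewrite ?rpredN.
by exists (x / y); split=> //; rewrite mulf_neq0 ?invr_eq0.
Qed.

Lemma commensurable_eqmod_squares (R : realType) (k : divringClosed R)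
    (x y z : R) :
  x != 0 -> y != 0 -> z != 0 ->
  commensurable k x y z <->
  eqmod_squares k (x ^+ 2) (y ^+ 2) /\ eqmod_squares k (y ^+ 2) (z ^+ 2).
Proof.
move=> x0 y0 z0; rewrite !eqmod_squares_ratio//.
split=> [[l [l0 lx ly lz]]|[xy yz]].
  split; rewrite -[_ / _](mulr1 _) -(divff l0) mulf_div ![_ * l]mulrC.
    exact: rpred_div.
  exact: rpred_div.
exists y^-1; rewrite invr_eq0 mulVf// rpred1; split=> //.
  by rewrite mulrC.
by rewrite mulrC -rpredV invf_div.
Qed.

(** Meant for a radius [s], the perimeter [w] with at most one side reversed, and [d] twice the
    signed area: up to sign, [s / a] is the quotient of [d / a ^+ 2] by [w / a]. *)
Lemma radius_eqmod_squares (R : realType) (k : divringClosed R)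
    (a s w d : R) : a != 0 -> d != 0 -> a ^+ 2 \in k -> w / a \in k -> d \in k ->
  s ^+ 2 * w ^+ 2 = d ^+ 2 ->
  [/\ s ^+ 2 \in k, s ^+ 2 != 0 & eqmod_squares k (s ^+ 2) (a ^+ 2)].
Proof.
move=> a0 d0 ak wk dk e.
have : s ^+ 2 * w ^+ 2 != 0 by rewrite e expf_neq0.
rewrite mulf_eq0 negb_or expf_eq0 /= => /andP[s0]; rewrite expf_eq0 /= => w0.
have es : s ^+ 2 / a ^+ 2 = (d / a ^+ 2 / (w / a)) ^+ 2.
  have -> : s ^+ 2 = d ^+ 2 / w ^+ 2 by rewrite -e mulfK ?expf_neq0.
  by field; rewrite a0 w0.
have qk : d / a ^+ 2 / (w / a) \in k by do 2!apply: rpred_div => //.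
split=> //.
  by rewrite -[s ^+ 2](@divfK _ (a ^+ 2)) ?expf_neq0// es rpredM// rpredX.
exists (d / a ^+ 2 / (w / a)); split=> //.
by rewrite !mulf_neq0 ?invr_eq0 ?mulf_neq0 ?invr_eq0 ?expf_neq0.
Qed.

Lemma dist_scale (R : realType) (P Q : 'rV[R]_2) (t : R) :
  0 <= t -> dist (t *: P) (t *: Q) = t * dist P Q.
Proof.
move=> t0; apply: sqr_inj; rewrite ?mulr_ge0 ?dist_ge0//.
by rewrite exprMn !dist_sqr !mxE; ring.
Qed.

Lemma cross_scale (R : realType) (A B C : 'rV[R]_2) (t : R) :
  cross (t *: A) (t *: B) (t *: C) = t ^+ 2 * cross A B C.
Proof. by rewrite /cross !mxE; ring. Qed.

Lemma areaE (R : realType) (A B C : 'rV[R]_2) : area A B C = `|cross A B C| / 2.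
Proof. by rewrite /area det_cross. Qed.

(** * Assembly of the equivalence and its consequences *)

Theorem theorem1p10 (R : realType) (k : divringClosed R)
    (A B C I IA IB IC Ge Na : 'rV[R]_2) (a b c r rA rB rC : R)
    (hA : A \is a mxOver k) (hB : B \is a mxOver k) (hC : C \is a mxOver k)
    (hABC : triangle A B C)
    (ha : a = dist B C) (hb : b = dist C A) (hc : c = dist A B)
    (hI : incircle A B C I r)
    (hIA : excircle A B C IA rA)
    (hIB : excircle B C A IB rB)
    (hIC : excircle C A B IC rC)
    (hGe : gergonne_point A B C Ge)
    (hNa : nagel_point A B C Na) :
  let T1 := exists P, P \in [:: I; IA; IB; IC; Ge; Na] /\ P \is a mxOver k in
  let T2 := eqmod_squares k (a ^+ 2) (b ^+ 2) /\
            eqmod_squares k (b ^+ 2) (c ^+ 2) in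
  (T1 <-> T2) /\
  (T1 ->
    (forall P, P \in [:: I; IA; IB; IC; Ge; Na] -> P \is a mxOver k) /\
    exists d q : R,
      [/\ d \in k, 0 < d, q \in k & 0 < q] /\
      (exists A' B' C' : 'rV[R]_2,
         heronian k A' B' C' /\
         [/\ A = (q * Num.sqrt d) *: A', B = (q * Num.sqrt d) *: B' &
             C = (q * Num.sqrt d) *: C']) /\
      (forall x, x \in [:: a; b; c; r; rA; rB; rC] ->
         [/\ x ^+ 2 \in k, x ^+ 2 != 0 & eqmod_squares k (x ^+ 2) d])).
Proof.
move=> T1 T2.
have d0 : cross A B C != 0 by apply/triangle_cross.
have d1 : cross B C A != 0 by rewrite cross_rot.
have d2 : cross C A B != 0 by rewrite -cross_rot.
have [BC CA AB] := cross_neq d0.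
have [pa pb pc] : [/\ 0 < a, 0 < b & 0 < c].
  by rewrite ha hb hc; split; exact: dist_gt0.
have [wI eI] := incenter_weights d0 hI.
have [wIA eIA] := excenter_weights d0 hIA.
have [wIB eIB] := excenter_weights d1 hIB.
have [wIC eIC] := excenter_weights d2 hIC.
(* The positivity is the strict triangle inequality; it makes the excenter weight sums nonzero. *)
have [[x0 y0 z0] wGe] := gergonne_weights d0 hGe.
rewrite cross_rot in eIB; rewrite -cross_rot in eIC.
have wNa := nagel_weights d0 hNa.
rewrite -?ha -?hb -?hc in wI eI wIA eIA wIB eIB wIC eIC x0 y0 z0 wGe wNa.
have [a0 b0 c0] : [/\ a != 0, b != 0 & c != 0] by rewrite !gt_eqF.
pose K := commensurable k a b c.
(* Each center separately is equivalent to [K], so a single one over [k] brings all the others. *)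
have all_iff P : P \in [:: I; IA; IB; IC; Ge; Na] -> P \is a mxOver k <-> K.
  rewrite !inE => /or4P[/eqP->|/eqP->|/eqP->|/or3P[/eqP->|/eqP->|/eqP->]].
  - by apply: weights_mxOver wI => //; lra.
  - rewrite (weights_mxOver hA hB hC d0 _ wIA); last lra.
    exact: commensurableN.
  - rewrite (weights_mxOver hB hC hA d1 _ wIB); last lra.
    rewrite commensurableN; split=> [/commensurable_rot|] /commensurable_rot //.
  - rewrite (weights_mxOver hC hA hB d2 _ wIC); last lra.
    by rewrite commensurableN; split=> [|/commensurable_rot] /commensurable_rot.
  - rewrite (weights_mxOver hA hB hC d0 _ wGe); last first.
      by apply: lt0r_neq0; rewrite !addr_gt0 ?mulr_gt0.
    rewrite commensurable_inverses ?lt0r_neq0//.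
    exact: commensurable_tangents.
  - rewrite (weights_mxOver hA hB hC d0 _ wNa); last lra.
    exact: commensurable_tangents.
have KT2 : K <-> T2 by exact: commensurable_eqmod_squares.
have T1K : T1 <-> K.
  split=> [[P [/all_iff PK /PK //]]|kK].
  by exists I; split; [rewrite mem_head | apply/all_iff; rewrite ?mem_head].
split; first by rewrite T1K.
move=> /T1K kK; split=> [P /all_iff PK|]; first exact/PK.
have [ba ca] : b / a \in k /\ c / a \in k.
  have /KT2[ab bc] := kK; move: ab bc; rewrite !eqmod_squares_ratio// => ab bc.
  have ba : b / a \in k by rewrite -rpredV invf_div.
  split=> //; have -> : c / a = b / a / (b / c) by field; rewrite a0 b0 c0.
  exact: rpred_div.
have a2k : a ^+ 2 \in k.
  move: hB hC => /mxOverP hB' /mxOverP hC'.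
  by rewrite ha dist_sqr rpredD// rpredX// rpredB.
have dk := cross_in hA hB hC.
(* The scaling factor is then [a]: the Heronian triangle has sides 1, [b / a], [c / a] and area
   [cross A B C] over [2 * a ^+ 2], up to sign. *)
exists (a ^+ 2), 1; rewrite rpred1 ltr01 exprn_gt0// mul1r sqrtr_sqr gtr0_norm//.
split=> //; split.
  have scaled : [/\ A = a *: (a^-1 *: A), B = a *: (a^-1 *: B) &
                    C = a *: (a^-1 *: C)].
    by split; rewrite scalerA divff ?scale1r.
  exists (a^-1 *: A), (a^-1 *: B), (a^-1 *: C); split=> //.
  rewrite /heronian !dist_scale ?invr_ge0 ?ltW// -ha -hb -hc.
  rewrite mulVf// rpred1 ![a^-1 * _]mulrC areaE cross_scale.
  split=> //.
    apply/triangle_cross.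
    by rewrite cross_scale mulf_neq0// expf_neq0// invr_eq0.
  have : a^-1 ^+ 2 * cross A B C / 2 \in k.
    by rewrite rpred_div ?rpred_nat// exprVn mulrC rpred_div.
  by case: ger0P; rewrite // mulNr rpredN.
have aa : a / a \in k by rewrite divff ?rpred1.
have side x : 0 < x -> x / a \in k ->
    [/\ x ^+ 2 \in k, x ^+ 2 != 0 & eqmod_squares k (x ^+ 2) (a ^+ 2)].
  move=> px xa; have nx := lt0r_neq0 px.
  split; [|exact: expf_neq0|exact/eqmod_squares_ratio].
  by rewrite -[x](divfK a0) exprMn rpredM// rpredX.
have radius s w : w / a \in k -> s ^+ 2 * w ^+ 2 = cross A B C ^+ 2 ->
    [/\ s ^+ 2 \in k, s ^+ 2 != 0 & eqmod_squares k (s ^+ 2) (a ^+ 2)].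
  by move=> wk; apply: radius_eqmod_squares a0 d0 _ wk dk.
move=> x; rewrite !inE.
case/or4P=> [/eqP->|/eqP->|/eqP->|/or4P[/eqP->|/eqP->|/eqP->|/eqP->]].
- exact: side.
- exact: side.
- exact: side.
- by apply: radius eI; rewrite !mulrDl !rpredD.
- by apply: radius eIA; rewrite !mulrDl mulNr !rpredD// rpredN.
- apply: radius eIB.
  by rewrite !mulrDl mulNr !rpredD// rpredN.
- apply: radius eIC.
  by rewrite !mulrDl mulNr !rpredD// rpredN.
Qed.
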